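(* Let $m\ge 1$ be an integer, let $\beta_m(h)=\frac{2m}{h}\cot\left(\frac{h}{2m}\right)$, and let $h_m$ be the smallest positive root of the equation $$\frac{h}{2m}\sin\left(\frac{h}{m}\right)=\cos\left(\frac{\pi}{m}\right)-\cos\left(\frac{h}{m}\right).$$ Then, for step lengths $h>0$: (1) For $h<m\pi$, $\varepsilon>-1$, integrations of the model problem $\ddot q=-q-\varepsilon q$ with either RKRm or KRKm are exponentially unstable if and only if $\varepsilon\in(\beta_m(h),\infty)$. (2) Consider a (consistent) $m$-stage rotation/kick splitting integrator $\psi_h$ with stability polynomial different from the stability polynomial $$T_m\left(\cos\left(\frac hm\right)-\frac{h\varepsilon}{2m}\sin\left(\frac hm\right)\right)$$ of the integrators RKRm/KRKm. Then, for $h\neq\pi,2\pi,\dots,(m-1)\pi$ and $h<h_m$, the (open) set of values of $\varepsilon>-1$ that lead to exponentially unstable integrations of the model problem by $\psi_h$ is strictly larger than the interval $(\beta_m(h),\infty)$ where RKRm and KRKm show exponential instability.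
   Context: Model problem: $\ddot q=-q-\varepsilon q$, $\varepsilon>-1$, written as $\dot q=p$, $\dot p=-q-\varepsilon q$, and split into $\dot q=p,\ \dot p=-q$ (rotation) and $\dot q=0,\ \dot p=-\varepsilon q$ (kick). On the column vector $(q,p)^T$ the corresponding flows are the matrices $$\varphi^{[R]}_t=\begin{bmatrix}\cos t&\sin t\\-\sin t&\cos t\end{bmatrix},\qquad \varphi^{[K]}_t=\begin{bmatrix}1&0\\-t\varepsilon&1\end{bmatrix}.$$ A (consistent) $m$-stage rotation/kick splitting integrator with step length $h>0$ is a map of one of the two forms $$\psi_h=\varphi^{[R]}_{r_{m+1}h}\circ\varphi^{[K]}_{k_mh}\circ\varphi^{[R]}_{r_mh}\circ\cdots\circ\varphi^{[K]}_{k_1h}\circ\varphi^{[R]}_{r_1h},\qquad \psi_h=\varphi^{[K]}_{k_{m+1}h}\circ\varphi^{[R]}_{r_mh}\circ\varphi^{[K]}_{k_mh}\circ\cdots\circ\varphi^{[R]}_{r_1h}\circ\varphi^{[K]}_{k_1h},$$ with real coefficients satisfying $\sum_i r_i=1$ and $\sum_i k_i=1$ (consistency); some coefficients may vanish. Let $M_{\varepsilon,h}$ be the real $2\times2$ matrix of $\psi_h$ for the model problem (it has determinant $1$). The stability polynomial of the integrator is the semitrace $P(\varepsilon,h)=\frac12\operatorname{tr}M_{\varepsilon,h}$; it is a polynomial in $\varepsilon$ of degree at most $m$, whose dependence on $h$ includes powers of $h$ and trigonometric functions. The integration is exponentially unstable if $|P(\varepsilon,h)|>1$ (equivalently, $M_{\varepsilon,h}$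 has a real eigenvalue of modulus $>1$). The Strang integrators are $\psi^{[RKR]}_h=\varphi^{[R]}_{h/2}\circ\varphi^{[K]}_h\circ\varphi^{[R]}_{h/2}$ and $\psi^{[KRK]}_h=\varphi^{[K]}_{h/2}\circ\varphi^{[R]}_h\circ\varphi^{[K]}_{h/2}$. The integrators RKRm and KRKm are $\psi^{[RKRm]}_h=(\psi^{[RKR]}_{h/m})^m$ and $\psi^{[KRKm]}_h=(\psi^{[KRK]}_{h/m})^m$; they share the same stability polynomial. $T_m$ is the Chebyshev polynomial of the first kind, $T_m(\cos\zeta)=\cos(m\zeta)$.
   Formalization: In (2), ''strictly larger than'' is replaced by ''not contained in'' (β_m(h),∞), as strict inclusion fails (m=2, r_i=1/3, k_i=1/2, h=π/2 is stable at ε=20/π>β_2(h)); ''different'' stability polynomials means different in ε at the given h. *)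

(* Defs.v *)
From HB Require Import structures.
From mathcomp Require Import all_boot all_order all_algebra.
From mathcomp Require Import all_classical all_reals all_analysis.
From mathcomp Require Import ring lra.

Set Implicit Arguments.
Unset Strict Implicit.
Unset Printing Implicit Defensive.

Import Order.TTheory GRing.Theory Num.Theory.
Import numFieldNormedType.Exports.

Local Open Scope classical_set_scope.
Local Open Scope ring_scope.

Definition mx2 (R : realType) (a b c d : R) : 'M[R]_2 :=
  \matrix_(i < 2, j < 2)
    if i == 0 then (if j == 0 then a else b) else (if j == 0 then c else d).

(* The flows act on column vectors (q, p)^T, so the composition of two flows *)
(* is the matrix product in the same order.                                  *)
Definition rotation (R : realType) (t : R) : 'M[R]_2 :=
  mx2 (cos t) (sin t) (- sin t) (cos t).

Definition kick (R : realType) (eps t : R) : 'M[R]_2 :=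
  mx2 1 0 (- t * eps) 1.

(* The coefficients r_1, r_2, .. and k_1, k_2, .. are stored 0-based, so that *)
(* r_(i+1) is r`_i and k_(i+1) is k`_i.                                       *)
Inductive splitting (R : realType) (m : nat) : Type :=
  | SplitRKR of m.+1.-tuple R & m.-tuple R
      (* SplitRKR r k = R_(r_(m+1)) K_(k_m) R_(r_m) .. K_(k_1) R_(r_1) *)
  | SplitKRK of m.-tuple R & m.+1.-tuple R.
      (* SplitKRK r k = K_(k_(m+1)) R_(r_m) K_(k_m) .. R_(r_1) K_(k_1) *)

Definition consistent (R : realType) (m : nat) (psi : splitting R m) : Prop :=
  match psi with
  | SplitRKR r k => \sum_(x <- r) x = 1 /\ \sum_(x <- k) x = 1
  | SplitKRK r k => \sum_(x <- r) x = 1 /\ \sum_(x <- k) x = 1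
  end.

(* A one-step map is represented by its matrix on the model problem, as a     *)
(* function of eps and of the step length h. The leftmost factor of           *)
(* \prod_(i < m) is the one for i = 0, whereas the stage applied last has to  *)
(* stand leftmost: whence rev_ord.                                            *)
Definition splitting_mx (R : realType) (m : nat) (psi : splitting R m)
    (eps h : R) : 'M[R]_2 :=
  match psi with
  | SplitRKR r k =>
      rotation (r`_m * h) *
      \prod_(i < m) (kick eps (k`_(rev_ord i) * h) *
                     rotation (r`_(rev_ord i) * h))
  | SplitKRK r k =>
      kick eps (k`_m * h) *
      \prod_(i < m) (rotation (r`_(rev_ord i) * h) *
                     kick eps (k`_(rev_ord i) * h))
  end.

Definition strangRKR (R : realType) (eps h : R) : 'M[R]_2 :=
  rotation (h / 2) * kick eps h * rotation (h / 2).

Definition strangKRK (R : realType) (eps h : R) : 'M[R]_2 :=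
  kick eps (h / 2) * rotation h * kick eps (h / 2).

Definition RKRm (R : realType) (m : nat) (eps h : R) : 'M[R]_2 :=
  strangRKR eps (h / m%:R) ^+ m.

Definition KRKm (R : realType) (m : nat) (eps h : R) : 'M[R]_2 :=
  strangKRK eps (h / m%:R) ^+ m.

Definition stability_poly (R : realType) (M : R -> R -> 'M[R]_2)
    (eps h : R) : R :=
  \tr (M eps h) / 2.

Definition exp_unstable (R : realType) (M : R -> R -> 'M[R]_2)
    (eps h : R) : Prop :=
  1 < `|stability_poly M eps h|.

(* For a general consistent splitting this set need not contain               *)
(* `]beta m h, +oo[: for m = 2, r = (1/3, 1/3, 1/3), k = (1/2, 1/2) and       *)
(* h = pi / 2, the value eps = 20 / pi > beta 2 h = 8 (1 + sqrt 2) / pi is    *)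
(* not in it. Hence a set of this kind is "strictly larger" than that         *)
(* interval in the sense of not being contained in it.                        *)
Definition unstable_set (R : realType) (M : R -> R -> 'M[R]_2) (h : R)
    : set R :=
  [set eps | -1 < eps /\ exp_unstable M eps h].

Fixpoint chebyshevT (R : realType) (n : nat) : {poly R} :=
  match n with
  | 0 => 1
  | n1.+1 =>
      match n1 with
      | 0 => 'X
      | n2.+1 => 'X * chebyshevT R n1 *+ 2 - chebyshevT R n2
      end
  end.

Lemma chebyshevT_cos (R : realType) (n : nat) (z : R) :
  (chebyshevT R n).[cos z] = cos (n%:R * z).
Proof.
have [//] : (chebyshevT R n).[cos z] = cos (n%:R * z) /\
            (chebyshevT R n.+1).[cos z] = cos (n.+1%:R * z).
elim: n => [|n [IH0 IH1]].
  by rewrite /= hornerC hornerX mul0r cos0 mul1r.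
split=> //.
have -> : chebyshevT R n.+2 = 'X * chebyshevT R n.+1 *+ 2 - chebyshevT R n.
  by [].
rewrite hornerD hornerN hornerMn mulrC hornerMX IH0 IH1.
have -> : n%:R * z = n.+1%:R * z - z by rewrite -natr1; ring.
have -> : n.+2%:R * z = n.+1%:R * z + z by rewrite -(natr1 n.+1); ring.
by rewrite cosB cosD; ring.
Qed.

Definition RKRm_poly (R : realType) (m : nat) (eps h : R) : R :=
  (chebyshevT R m).[cos (h / m%:R)
                    - h * eps / (2 * m%:R) * sin (h / m%:R)].

Definition cot (R : realType) (x : R) : R := cos x / sin x.

Definition beta (R : realType) (m : nat) (h : R) : R :=
  2 * m%:R / h * cot (h / (2 * m%:R)).

Definition hm_equation (R : realType) (m : nat) (h : R) : Prop :=
  h / (2 * m%:R) * sin (h / m%:R) = cos (pi / m%:R) - cos (h / m%:R).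

Definition smallest_positive_root (R : realType) (m : nat) (hm : R) : Prop :=
  [/\ 0 < hm, hm_equation m hm &
      forall h : R, 0 < h -> hm_equation m h -> hm <= h].

Lemma smallest_positive_root_exists (R : realType) (m : nat) :
  (0 < m)%N -> exists hm : R, smallest_positive_root m hm.
Proof.
move=> m0.
have m0R : 0 < m%:R :> R by rewrite ltr0n.
pose f (x : R) := cos (x / m%:R) + x / (2 * m%:R) * sin (x / m%:R)
                  - cos (pi / m%:R).
have fE x : hm_equation m x <-> f x = 0.
  by rewrite /hm_equation /f; split=> H; lra.
have cf : continuous f.
  move=> x; have cm : y / m%:R @[y --> x] --> x / m%:R by exact: mulrr_continuous.
  apply: cvgB; last exact: cvg_cst.
  apply: cvgD; first by apply: continuous_cvg => //; exact: continuous_cos.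
  apply: cvgM; first exact: mulrr_continuous.
  by apply: continuous_cvg => //; exact: continuous_sin.
have pm : pi / m%:R <= pi :> R.
  by rewrite ler_pdivrMr // ler_peMr ?pi_ge0 // ler1n.
have pm0 : 0 < pi / m%:R :> R by rewrite divr_gt0 ?pi_gt0.
have f0 : 0 < f 0.
  rewrite /f !mul0r cos0 addr0 subr_gt0 -[X in _ < X]cos0.
  have [Ip I0] : (pi / m%:R : R) \in `[0, pi] /\ (0 : R) \in `[0, pi].
    by rewrite !in_itv /= lexx pi_ge0 pm ltW.
  by rewrite (ltr_cos I0 Ip).
have fp : f (m%:R * pi) <= 0.
  rewrite /f [m%:R * pi / m%:R]mulrAC divff ?gt_eqF // mul1r cospi sinpi mulr0.
  by have := cos_geN1 (pi / m%:R : R); lra.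
have b0 : 0 <= m%:R * pi :> R by rewrite mulr_ge0 ?pi_ge0 // ltW.
pose S := `[0, m%:R * pi]%classic `&` f @^-1` [set 0].
have S0 : S !=set0.
  have [] := @IVT R f 0 (m%:R * pi) 0 b0.
  - exact: continuous_subspaceT.
  - by rewrite ge_min fp orbT le_max (ltW f0).
  - by move=> c cI fc; exists c; split.
have cS : compact S.
  apply: compact_closedI; first exact: segment_compact.
  by apply: closed_comp => [x _|]; [exact: cf|exact: closed_eq].
have cid : {within S, continuous (@id R)} by apply: continuous_subspaceT => x.
have [c cS' cmin] := compact_EVT_min S0 cS cid.
move: cS'; rewrite inE => -[/=]; rewrite in_itv /= => /andP[c0 cp] fc.
exists c; split.
- rewrite lt_neqAle c0 andbT; apply/eqP => c0'.
  by move: f0; rewrite [X in f X]c0' (fc : f c = 0) ltxx.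
- exact/fE.
- move=> h h0 /fE fh; have [hp|/ltW ph] := leP h (m%:R * pi).
    by apply: (cmin h); rewrite inE; split=> //=; rewrite in_itv /= hp ltW.
  exact: le_trans ph.
Qed.

(* Main.v *)
(* As polynomials in [eps], the semitrace [P] of a consistent splitting and the
   semitrace [Q = T_m o x] of RKRm, with [x] affine in [eps], have degree at
   most [m], and consistency fixes their coefficients of degree 0 and 1, so that
   [P - Q = eps^2 E] with [E] of degree at most [m - 2]. Let [a_0 < .. < a_(m-1)]
   be the points where [x] equals [cos (j pi / m)], [1 <= j <= m]: there [Q] is
   alternately -1 and 1. The assumption [h < h_m] says that [-1 < a_0], and
   [a_(m-1) = beta_m h]; moreover [a_j <> 0] since [h] avoids the multiples of
   [pi]. If [|P| <= 1] for [-1 < eps <= beta_m h], the signs of [E] at these [m]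
   points weakly alternate, so that all the terms of the divided difference
   [E[a_0, .., a_(m-1)]] have the same sign. As this divided difference
   vanishes, so does [E] at every [a_j], and hence [E = 0]. *)
Require Import Defs.
From HB Require Import structures.
From mathcomp Require Import all_boot all_order all_algebra.
From mathcomp Require Import all_classical all_reals all_analysis.
From mathcomp Require Import ring lra.

Set Implicit Arguments.
Unset Strict Implicit.
Unset Printing Implicit Defensive.

Import Order.TTheory GRing.Theory Num.Theory.
Import numFieldNormedType.Exports.

Local Open Scope classical_set_scope.
Local Open Scope ring_scope.

(** * Polynomials with weakly alternating values at increasing points *)

(** Exactly the [n - i] factors with [j > i] are negative. *)
Lemma sgn_prod_sub_nodes (F : realFieldType) (n : nat) (x : nat -> F)
    (i : 'I_n.+1) :
  {homo x : j k / (j < k)%N >-> j < k} ->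
  0 < (-1) ^+ (n - i) * \prod_(j < n.+1 | j != i) (x i - x j).
Proof.
move=> x_incr.
have -> : (-1) ^+ (n - i) =
    \prod_(j < n.+1 | j != i) (if (j <= i)%N then 1 else -1 : F).
  have i_n : (i < n.+1)%N := ltn_ord i.
  pose s (j : nat) : F := if (j <= i)%N then 1 else -1.
  transitivity (\prod_(j < n.+1) s j); last first.
    by rewrite (bigD1 i) //= /s leqnn mul1r.
  rewrite -(big_mkord xpredT s) (@big_cat_nat _ _ _ i.+1) //=.
  rewrite big_nat big1 ?mul1r => [|j /andP[_ j_i]]; last by rewrite /s -ltnS j_i.
  rewrite big_nat (eq_bigr (fun=> -1)) => [|j /andP[i_j _]].
    by rewrite -big_nat prodr_const_nat subSS.
  by rewrite /s leqNgt i_j.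
rewrite -big_split /=; apply: prodr_gt0 => j ji.
case: ltngtP (ji) => [ji'|ij|/val_inj->]; last by rewrite eqxx.
- by rewrite mul1r subr_gt0 x_incr.
- by rewrite mulN1r opprB subr_gt0 x_incr.
Qed.

(** The divided difference of [p] at [a 0, .., a n] is the coefficient of degree [n] of its Lagrange
    interpolant, which is [p] itself, so it vanishes. Its terms [p.[a i] / w i] all have the weak
    sign [(-1) ^+ n], hence vanish one by one. *)
Lemma weakly_alternating_poly_eq0 (F : realFieldType) (n : nat) (a : nat -> F)
    (p : {poly F}) :
  (forall i, (i < n)%N -> a i < a i.+1) -> (size p <= n)%N ->
  (forall i, (i <= n)%N -> 0 <= (-1) ^+ i * p.[a i]) -> p = 0.
Proof.
move=> a_incr sz_p p_alt.
(* The Lagrange basis is taken on an injective sequence over all of [nat]: beyond [n] the points are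
   continued by unit steps. *)
pose x k := if (k <= n)%N then a k else a n + (k - n)%:R.
have x_incr : {homo x : j k / (j < k)%N >-> j < k}.
  apply: homo_ltn => [? ? ?|k]; first exact: lt_trans.
  rewrite /x; case: (ltngtP k n) => [kn|nk|->]; first exact: a_incr.
  - by rewrite ltrD2l ltr_nat ltn_sub2r // ltnS ltnW.
  - by rewrite ltrDl subSnn ltr01.
have x_inj : injective x.
  move=> j k xjk; case: (ltngtP j k) => // /x_incr; by rewrite xjk ltxx.
have p_gen := lagrange_gen (n := n.+1) isT x_inj (leqW sz_p).
pose w (i : 'I_n.+1) := \prod_(j < n.+1 | j != i) (x i - x j).
pose s : F := \sum_(i < n.+1) (-1) ^+ n * (p.[x i] / w i).
have s0 : s = 0.
  have : p`_n = 0 by rewrite nth_default.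
  rewrite {1}p_gen coef_sum => p_n.
  rewrite /s -big_distrr /= -[RHS](mulr0 ((-1) ^+ n)); congr (_ * _).
  rewrite -[RHS]p_n.
  apply: eq_bigr => i _; rewrite coefCM; congr (_ * _).
  (* Each Lagrange basis polynomial has degree exactly [n] and leading coefficient [(w i)^-1]. *)
  transitivity (lead_coef (tnth (n.+1.-lagrange x) i : {poly F})); last first.
    by rewrite lead_coefE size_lagrange_.
  rewrite lagrangeE //= lead_coefM lead_coefC (monicP _) ?monic_prod_XsubC //.
  by rewrite mulr1 horner_prod (eq_bigr _ (fun _ _ => hornerXsubC _ _)).
have ge0 (i : 'I_n.+1) : true -> 0 <= (-1) ^+ n * (p.[x i] / w i).
  move=> _; have i_n : (i <= n)%N by rewrite -ltnS.
  have := p_alt i i_n; have := sgn_prod_sub_nodes i x_incr; rewrite -/(w i).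
  rewrite /x i_n => w0 p0.
  have -> : (-1) ^+ n * (p.[a i] / w i) =
      ((-1) ^+ i * p.[a i]) / ((-1) ^+ (n - i) * w i).
    rewrite -{1}(subnK i_n) exprD invfM -exprVn invrN1; ring.
  by rewrite divr_ge0 // ltW.
have {}s0 := psumr_eq0P ge0 s0.
rewrite p_gen big1 // => i _; move/eqP: (s0 i isT).
rewrite mulf_eq0 signr_eq0 /= mulf_eq0 invr_eq0.
have := sgn_prod_sub_nodes i x_incr; rewrite -/(w i).
case: eqVneq => [-> _ _|/= _]; first by rewrite mul0r.
by case: eqP => // ->; rewrite mulr0 ltxx.
Qed.

(** * Two-by-two matrices and the two flows *)

Lemma mx2_mul (R : realType) (a b c d a' b' c' d' : R) :
  mx2 a b c d * mx2 a' b' c' d' =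
  mx2 (a * a' + b * c') (a * b' + b * d') (c * a' + d * c') (c * b' + d * d').
Proof.
apply/matrixP => i j; rewrite !mxE big_ord_recl big_ord1 !mxE /=.
by case: i => [[|[|]]] //=; case: j => [[|[|]]].
Qed.

Lemma mx2_eta (R : realType) (M : 'M[R]_2) :
  M = mx2 (M ord0 ord0) (M ord0 ord_max) (M ord_max ord0) (M ord_max ord_max).
Proof.
apply/matrixP => i j; rewrite !mxE.
by case: i => [[|[|]]] //= ?; case: j => [[|[|]]] //= ?; congr (M _ _);
  apply/val_inj.
Qed.

Lemma tr_mx2 (R : realType) (a b c d : R) : \tr (mx2 a b c d) = a + d.
Proof. by rewrite /mxtrace big_ord_recl big_ord1 !mxE. Qed.

Lemma det_mx2 (R : realType) (a b c d : R) : \det (mx2 a b c d) = a * d - b * c.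
Proof.
rewrite (expand_det_row _ ord0) big_ord_recl big_ord1 /cofactor !det_mx11 !mxE /=.
by rewrite /= expr0 expr1; ring.
Qed.

Lemma mx2_1 (R : realType) : 1 = mx2 1 0 0 1 :> 'M[R]_2.
Proof.
apply/matrixP => i j; rewrite !mxE.
by case: i => [[|[|]]] //=; case: j => [[|[|]]].
Qed.

Lemma det_rotation (R : realType) (t : R) : \det (rotation t) = 1.
Proof. by rewrite det_mx2 -(cos2Dsin2 t); ring. Qed.

Lemma det_kick (R : realType) (eps t : R) : \det (kick eps t) = 1.
Proof. by rewrite det_mx2; ring. Qed.

Lemma rotationD (R : realType) (s t : R) :
  rotation (s + t) = rotation s * rotation t.
Proof. by rewrite mx2_mul /rotation sinD cosD; congr mx2; ring. Qed.

Lemma kickD (R : realType) (eps s t : R) :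
  kick eps (s + t) = kick eps s * kick eps t.
Proof. by rewrite mx2_mul /kick; congr mx2; ring. Qed.

(** * Stability polynomials of RKRm and KRKm *)

(** By Cayley-Hamilton, [M ^+ 2 = \tr M *: M - 1], so the semitraces of the powers of [M] obey the
    Chebyshev recurrence. *)
Lemma tr_expr_chebyshev (R : realType) (M : 'M[R]_2) (n : nat) :
  \det M = 1 -> \tr (M ^+ n) / 2 = (chebyshevT R n).[\tr M / 2].
Proof.
move=> M1.
have CH : M ^+ 2 = \tr M *: M - 1.
  move: M1; rewrite (mx2_eta M); move: (M _ _) (M _ _) (M _ _) (M _ _).
  move=> a b c d; rewrite det_mx2 => M1; rewrite expr2 mx2_mul tr_mx2 mx2_1.
  apply/matrixP => i j; rewrite !mxE.
  by case: i => [[|[|]]] //= ?; case: j => [[|[|]]] //= ?; rewrite -?M1; ring.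
have [//] : \tr (M ^+ n) / 2 = (chebyshevT R n).[\tr M / 2] /\
            \tr (M ^+ n.+1) / 2 = (chebyshevT R n.+1).[\tr M / 2].
elim: n => [|n [IH0 IH1]].
  by rewrite expr0 expr1 mxtrace1 divff ?pnatr_eq0 //= hornerC hornerX.
split=> //; rewrite -[X in M ^+ X]/(2 + n)%N exprD CH mulrBl mul1r.
rewrite -scalerAl -exprS.
rewrite linearB linearZ.
have -> : chebyshevT R n.+2 = 'X * chebyshevT R n.+1 *+ 2 - chebyshevT R n.
  by [].
rewrite hornerD hornerN hornerMn hornerM hornerX -IH0 -IH1.
by rewrite /=; field.
Qed.

Lemma tr_strangRKR (R : realType) (eps t : R) :
  \tr (strangRKR eps t) = 2 * cos t - t * eps * sin t.
Proof.
rewrite /strangRKR mxtrace_mulC mulmxE mulrA -rotationD -splitr.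
by rewrite mx2_mul tr_mx2; ring.
Qed.

Lemma tr_strangKRK (R : realType) (eps t : R) :
  \tr (strangKRK eps t) = 2 * cos t - t * eps * sin t.
Proof.
rewrite /strangKRK mxtrace_mulC mulmxE mulrA -kickD -splitr.
by rewrite mx2_mul tr_mx2; ring.
Qed.

Lemma stability_poly_RKRm (R : realType) (m : nat) (eps h : R) :
  (0 < m)%N -> stability_poly (@RKRm R m) eps h = RKRm_poly m eps h.
Proof.
move=> m0; rewrite /stability_poly /RKRm tr_expr_chebyshev; last first.
  by rewrite /strangRKR -!mulmxE !det_mulmx !det_rotation det_kick !mulr1.
rewrite /RKRm_poly tr_strangRKR; congr (_.[_]).
by field; rewrite pnatr_eq0 -lt0n.
Qed.

Lemma stability_poly_KRKm (R : realType) (m : nat) (eps h : R) :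
  (0 < m)%N -> stability_poly (@KRKm R m) eps h = RKRm_poly m eps h.
Proof.
move=> m0; rewrite /stability_poly /KRKm tr_expr_chebyshev; last first.
  by rewrite /strangKRK -!mulmxE !det_mulmx !det_kick det_rotation !mulr1.
rewrite /RKRm_poly tr_strangKRK; congr (_.[_]).
by field; rewrite pnatr_eq0 -lt0n.
Qed.

(** * Elementary estimates on Chebyshev polynomials and on the cosine *)

Lemma chebyshevT_itv (R : realType) (n : nat) (x : R) :
  `|x| <= 1 -> `|(chebyshevT R n).[x]| <= 1.
Proof.
rewrite ler_norml => x1; rewrite -[x]acosK ?in_itv //= chebyshevT_cos.
exact: cos_max.
Qed.

Lemma chebyshevT_gt1 (R : realType) (n : nat) (x : R) :
  (0 < n)%N -> 1 < `|x| -> 1 < `|(chebyshevT R n).[x]|.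
Proof.
case: n => // n _ x1; pose T k := (chebyshevT R k).[x].
(* Monotonicity of [|T k|] is carried along: it gives [|T n.+2| >= 2 |x| |T n.+1| - |T n| > |T
   n.+1|]. *)
suff : 1 < `|T n.+1| /\ `|T n| <= `|T n.+1| by case.
elim: n => [|n [T1 T01]].
  by rewrite /T /= hornerX hornerC normr1 ltW.
have TE : T n.+2 = 2 * x * T n.+1 - T n.
  rewrite /T; have -> : chebyshevT R n.+2 =
    'X * chebyshevT R n.+1 *+ 2 - chebyshevT R n by [].
  by rewrite hornerD hornerN hornerMn hornerM hornerX; ring.
have := lerB_dist (2 * x * T n.+1) (T n); rewrite -TE !normrM.
rewrite (ger0_norm (ler0n _ 2)) => T2.
have : `|T n.+1| < `|x| * `|T n.+1| by rewrite ltr_pMl // (lt_trans ltr01).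
by split; lra.
Qed.

Lemma chebyshevT_gt1E (R : realType) (n : nat) (x : R) :
  (0 < n)%N -> (1 < `|(chebyshevT R n).[x]|) = (1 < `|x|).
Proof.
move=> n0; apply/idP/idP; last exact: chebyshevT_gt1.
by apply: contraTT; rewrite -!leNgt; exact: chebyshevT_itv.
Qed.

(** The function [sin y - y * cos y] vanishes at 0 and has derivative [y * sin y], nonnegative on
    [[0, pi]]. *)
Lemma mulr_cos_le_sin (R : realType) (x : R) :
  0 <= x <= pi -> x * cos x <= sin x.
Proof.
case/andP => x0 xpi.
pose f (y : R) := sin y - y * cos y.
have df (y : R) : is_derive y 1 f (y * sin y).
  rewrite /f; apply: is_derive_eq; rewrite /GRing.scale /=; ring.
suff : f 0 <= f x by rewrite /f sin0 mul0r subr0 subr_ge0.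
apply: (@ger0_derive1_le_cc _ f 0 pi) => //.
- move=> y; rewrite in_itv /= => /andP[y0 ypi].
  rewrite derive1E (@derive_val _ _ _ _ _ _ _ (df y)).
  by rewrite mulr_ge0 ?ltW // sin_gt0_pi ?y0.
- apply: derivable_within_continuous => y _; by have [] := df y.
- by rewrite in_itv /= lexx pi_ge0.
- by rewrite in_itv /= x0.
Qed.

(** * Semitraces as polynomials in [eps], with their first two coefficients *)

(* Up to degree one in [eps], [M] is [rotation t + eps B] where
   [\tr (rotation s * B) = - k * sin (t + s)] for all [s]: the two equations on
   the coefficients of degree one say so for [s = 0] and [s = pi / 2]. *)
Definition eps_expansion (R : realType) (M : R -> 'M[R]_2) (n p : nat)
    (t k : R) : Prop :=
  exists a b c d : {poly R},
  [/\ forall eps, M eps = mx2 a.[eps] b.[eps] c.[eps] d.[eps],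
      [/\ (size a <= n)%N, (size b <= n)%N, (size c <= p)%N & (size d <= p)%N],
      [/\ a`_0 = cos t, b`_0 = sin t, c`_0 = - sin t & d`_0 = cos t],
      a`_1 + d`_1 = - k * sin t & c`_1 - b`_1 = - k * cos t].

Lemma eps_expansion1 (R : realType) :
  eps_expansion (fun=> 1 : 'M[R]_2) 1 1 0 0.
Proof.
exists 1, 0, 0, 1; rewrite sin0 cos0; split.
- by move=> eps; rewrite !hornerE mx2_1.
- by rewrite size_poly0 size_poly1.
- by rewrite !coef0 !coef1 oppr0.
- by rewrite !coef1 /=; ring.
- by rewrite !coef0; ring.
Qed.

(** A rotation mixes the rows, so both get the larger size bound; the two conditions of degree one
    are themselves rotated by [s]. *)
Lemma eps_expansion_rotation (R : realType) (M : R -> 'M[R]_2) (n p : nat)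
    (t k s : R) : (n <= p)%N ->
  eps_expansion M n p t k ->
  eps_expansion (fun eps => rotation s * M eps) p p (s + t) k.
Proof.
move=> np [a [b [c [d [ME [sa sb sc sd] [a0 b0 c0 d0] t1 t2]]]]].
exists (cos s *: a + sin s *: c), (cos s *: b + sin s *: d),
  (cos s *: c - sin s *: a), (cos s *: d - sin s *: b).
have sz (q r : {poly R}) (u v : R) : (size q <= p)%N -> (size r <= p)%N ->
    (size (u *: q + v *: r)%R <= p)%N.
  move=> qp rp; rewrite (leq_trans (size_polyD _ _)) // geq_max.
  by rewrite !(leq_trans (size_scale_leq _ _)).
split.
- by move=> eps; rewrite ME mx2_mul !hornerE; congr mx2; rewrite /=; ring.
- by rewrite -!scaleNr !sz // (leq_trans _ np).
- rewrite !(coefD, coefN, coefZ) a0 b0 c0 d0 sinD cosD.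
  by split; ring.
- rewrite !(coefD, coefN, coefZ).
  have -> : cos s * a`_1 + sin s * c`_1 + (cos s * d`_1 - sin s * b`_1) =
    cos s * (a`_1 + d`_1) + sin s * (c`_1 - b`_1) by ring.
  by rewrite t1 t2 sinD; ring.
- rewrite !(coefD, coefN, coefZ).
  have -> : cos s * c`_1 - sin s * a`_1 - (cos s * b`_1 + sin s * d`_1) =
    cos s * (c`_1 - b`_1) - sin s * (a`_1 + d`_1) by ring.
  by rewrite t1 t2 cosD; ring.
Qed.

(** A kick only subtracts a multiple of [eps] times the top row from the bottom row. This is why the
    rows carry separate size bounds. *)
Lemma eps_expansion_kick (R : realType) (M : R -> 'M[R]_2) (n p q : nat)
    (t k l : R) : (n < q)%N -> (p <= q)%N ->
  eps_expansion M n p t k ->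
  eps_expansion (fun eps => kick eps l * M eps) n q t (l + k).
Proof.
move=> nq pq [a [b [c [d [ME [sa sb sc sd] [a0 b0 c0 d0] t1 t2]]]]].
exists a, b, (c - l *: (a * 'X)), (d - l *: (b * 'X)).
have sz (r u : {poly R}) : (size r <= p)%N -> (size u <= n)%N ->
    (size (r - l *: (u * 'X))%R <= q)%N.
  move=> rp un; rewrite (leq_trans (size_polyD _ _)) // geq_max.
  rewrite (leq_trans rp pq) size_polyN (leq_trans (size_scale_leq _ _)) //.
  rewrite (leq_trans (size_polyMleq _ _)) // size_polyX addn2.
  exact: leq_ltn_trans un nq.
split.
- by move=> eps; rewrite ME mx2_mul !hornerE; congr mx2; rewrite /=; ring.
- by rewrite !sz.
- by rewrite !(coefD, coefN, coefZ, coefMX) /= a0 b0 c0 d0; split => //; ring.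
- by rewrite !(coefD, coefN, coefZ, coefMX) /= b0 addrA t1; ring.
- rewrite !(coefD, coefN, coefZ, coefMX) /= a0.
  by rewrite addrAC t2; ring.
Qed.

(** Since the leftmost factor is a kick, the top row has degree one less than the bottom row;
    [m.-1.+1] is [m], except that it is 1 for the empty product. *)
Lemma eps_expansion_prod (R : realType) (m : nat) (k r : 'I_m -> R) :
  eps_expansion (fun eps => \prod_(i < m) (kick eps (k i) * rotation (r i)))
    m.-1.+1 m.+1 (\sum_(i < m) r i) (\sum_(i < m) k i).
Proof.
elim: m k r => [|m IH] k r.
  have -> : (fun eps => \prod_(i < 0) (kick eps (k i) * rotation (r i))) =
      fun=> 1.
    by apply/funext => eps; rewrite big_ord0.
  by rewrite !big_ord0; exact: eps_expansion1.
have -> : (fun eps => \prod_(i < m.+1) (kick eps (k i) * rotation (r i))) =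
    fun eps => kick eps (k ord0) * (rotation (r ord0) *
      \prod_(i < m) (kick eps (k (lift ord0 i)) * rotation (r (lift ord0 i)))).
  by apply/funext => eps; rewrite big_ord_recl mulrA.
rewrite !big_ord_recl; apply: (@eps_expansion_kick _ _ m.+1 m.+1) => //.
by apply: (@eps_expansion_rotation _ _ m.-1.+1) => //; case: (m).
Qed.

Lemma eps_expansion_tr (R : realType) (M : R -> 'M[R]_2) (n p : nat)
    (t k : R) : (n <= p)%N -> eps_expansion M n p t k ->
  exists P : {poly R}, [/\ (size P <= p)%N, forall eps, \tr (M eps) = P.[eps],
    P`_0 = 2 * cos t & P`_1 = - k * sin t].
Proof.
move=> np [a [b [c [d [ME [sa _ _ sd] [a0 _ _ d0] t1 _]]]]].
exists (a + d); split.
- by rewrite (leq_trans (size_polyD _ _)) // geq_max sd (leq_trans sa).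
- by move=> eps; rewrite ME tr_mx2 hornerE.
- by rewrite coefD a0 d0; ring.
- by rewrite coefD.
Qed.

(* [K_m R_(m-1) K_(m-1) .. R_0 K_0 = (K_m R_(m-1)) .. (K_1 R_0) K_0] *)
Lemma prod_shift (A : pzRingType) (f g : nat -> A) (m : nat) :
  g m * \prod_(i < m) (f (rev_ord i) * g (rev_ord i)) =
  \prod_(i < m) (g (rev_ord i).+1 * f (rev_ord i)) * g 0.
Proof.
elim: m => [|m IH]; first by rewrite !big_ord0 mulr1 mul1r.
rewrite !big_ord_recl /= subn1 /= -!mulrA -IH.
by congr (_ * (_ * _)).
Qed.

Lemma sum_tuple_rev (R : realType) (m : nat) (r : m.-tuple R) (h : R) :
  \sum_(i < m) r`_(rev_ord i) * h = (\sum_(x <- r) x) * h.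
Proof.
rewrite (reindex_inj rev_ord_inj) mulr_suml big_tuple.
by apply: eq_bigr => i _; rewrite (tnth_nth 0) rev_ordK.
Qed.

Lemma tr_splitting_mx_poly (R : realType) (m : nat) (psi : splitting R m)
    (h : R) : (0 < m)%N -> consistent psi ->
  exists P : {poly R}, [/\ (size P <= m.+1)%N,
    forall eps, \tr (splitting_mx psi eps h) = P.[eps],
    P`_0 = 2 * cos h & P`_1 = - h * sin h].
Proof.
move=> m0; case: psi => r k [r1 k1].
  have E := eps_expansion_prod (fun i => k`_(rev_ord i) * h)
    (fun i : 'I_m => r`_(rev_ord i) * h).
  have := eps_expansion_rotation (r`_m * h) _ E.
  rewrite prednK // => /(_ (leqnSn _)).
  rewrite sum_tuple_rev k1 mul1r.
  suff -> : r`_m * h + \sum_(i < m) r`_(rev_ord i) * h = h.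
    exact: eps_expansion_tr.
  rewrite -[RHS]mul1r -r1 -sum_tuple_rev big_ord_recl /= subn1.
  by congr (_ + _); apply: eq_bigr => i _.
(* By cyclicity of the trace, the kick applied first is moved to the left end, next to the one
   applied last. Two adjacent kicks act as one, so the degree stays at most [m]. *)
have E := eps_expansion_prod (fun i => k`_(rev_ord i).+1 * h)
    (fun i : 'I_m => r`_(rev_ord i) * h).
have := @eps_expansion_kick _ _ _ m.+1 m.+1 _ _ (k`_0 * h) _ (leqnn _) E.
rewrite prednK // => /(_ (leqnn _)).
rewrite sum_tuple_rev r1 mul1r.
have -> : k`_0 * h + \sum_(i < m) k`_(rev_ord i).+1 * h = h.
  rewrite -[RHS]mul1r -k1 -sum_tuple_rev big_ord_recr /= subnn addrC.
  by congr (_ + _); apply: eq_bigr => i _; rewrite subSS subnSK.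
move/(eps_expansion_tr (leqnSn _)) => [P [sP trP P0 P1]].
exists P; split=> // eps; rewrite -trP [RHS]mxtrace_mulC mulmxE.
by rewrite -(prod_shift (fun i => rotation (r`_i * h))
  (fun i => kick eps (k`_i * h))).
Qed.

(** An induction on the power, each Strang step containing one kick, avoids merging adjacent half
    rotations into a [splitting]. *)
Lemma tr_RKRm_poly (R : realType) (m : nat) (h : R) : (0 < m)%N ->
  exists P : {poly R}, [/\ (size P <= m.+1)%N,
    forall eps, \tr (RKRm m eps h) = P.[eps],
    P`_0 = 2 * cos h & P`_1 = - h * sin h].
Proof.
move=> m0; pose t := h / m%:R.
have E (n : nat) : eps_expansion (fun eps => strangRKR eps t ^+ n) n.+1 n.+1
    (n%:R * t) (n%:R * t).
  elim: n => [|n IH].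
    have -> : (fun eps => strangRKR eps t ^+ 0) = fun=> 1 by apply/funext.
    by rewrite mul0r; exact: eps_expansion1.
  have -> : (fun eps => strangRKR eps t ^+ n.+1) = fun eps =>
      rotation (t / 2) * (kick eps t * (rotation (t / 2) * strangRKR eps t ^+ n)).
    by apply/funext => eps; rewrite exprS /strangRKR !mulrA.
  have := eps_expansion_rotation (t / 2) (leqnn _) IH.
  move/(eps_expansion_kick t (leqnn _) (leqnSn _)).
  move/(eps_expansion_rotation (t / 2) (leqnSn _)).
  have -> : t / 2 + (t / 2 + n%:R * t) = n.+1%:R * t by rewrite -natr1; field.
  by have -> : t + n%:R * t = n.+1%:R * t by rewrite -natr1; ring.
have := eps_expansion_tr (leqnn _) (E m).
by have -> : m%:R * t = h by rewrite mulrC divfK // pnatr_eq0 -lt0n.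
Qed.

(** * The instability threshold of RKRm and KRKm *)

(** Let [x] be the argument of [T_m], and [c], [s] the cosine and sine of [phi = h / (2 m)]. Then
    [1 - x = 2 s (s + phi eps c)] is positive for [eps > -1], as [phi c <= s]. Instability thus
    means [x < -1], where [- x - 1 = 2 c (eps phi s - c)]. *)
Lemma RKRm_poly_gt1 (R : realType) (m : nat) (h eps : R) :
  (0 < m)%N -> 0 < h -> h < m%:R * pi -> -1 < eps ->
  (1 < `|RKRm_poly m eps h|) = (beta m h < eps).
Proof.
move=> m0 h0 hpi eps1.
have m0R : 0 < m%:R :> R by rewrite ltr0n.
have m_neq0 : m%:R != 0 :> R by rewrite gt_eqF.
pose phi := h / (2 * m%:R).
have phi0 : 0 < phi by rewrite divr_gt0 // mulr_gt0.
have phi_pi : phi < pi / 2.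
  by rewrite ltr_pdivrMr ?mulr_gt0 // mulrA divfK ?pnatr_eq0 // mulrC.
have c0 : 0 < cos phi.
  rewrite cos_gt0_pihalf // phi_pi andbT (lt_trans _ phi0) //.
  by rewrite oppr_lt0 divr_gt0 ?pi_gt0.
have s0 : 0 < sin phi by rewrite sin_gt0_pihalf // phi0.
have tan_ge : phi * cos phi <= sin phi.
  rewrite mulr_cos_le_sin // ltW //= ltW // (lt_trans phi_pi) //.
  by have := @pi_gt0 R; lra.
have sc := cos2Dsin2 phi.
rewrite /RKRm_poly chebyshevT_gt1E //.
have -> : h / m%:R = phi + phi by rewrite /phi; field.
have -> : h * eps / (2 * m%:R) = phi * eps by rewrite /phi; field.
rewrite cosD sinD.
set c := cos phi; set s := sin phi; rewrite -/c -/s in c0 s0 tan_ge sc.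
have -> : beta m h = c / (phi * s).
  rewrite /beta /cot -/phi -/c -/s /phi; field.
  by rewrite m_neq0 !gt_eqF.
set x := _ - _.
have x_lt1 : x < 1.
  have : 0 < s * (s + phi * eps * c).
    rewrite mulr_gt0 //; have : 0 < (phi * c) * (eps + 1).
      by apply: mulr_gt0; [exact: mulr_gt0|lra].
    by lra.
  by rewrite /x -sc; nra.
rewrite ltr_normr ltNge (ltW x_lt1) /= ltr_pdivrMr ?(mulr_gt0 phi0) //.
have xE : - x - 1 = 2 * c * (eps * (phi * s) - c).
  have ss : s * s = 1 - c * c by lra.
  by rewrite /x ss; ring.
by rewrite -subr_gt0 xE pmulr_rgt0 ?subr_gt0 // mulr_gt0.
Qed.

(** * Step lengths below [h_m] *)

(** Otherwise the intermediate value theorem would give a root in []0, h]], below the smallest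
    one. *)
Lemma lt_smallest_positive_root (R : realType) (m : nat) (hm h : R) :
  (0 < m)%N -> smallest_positive_root m hm -> 0 < h -> h < hm ->
  cos (pi / m%:R) - cos (h / m%:R) < h / (2 * m%:R) * sin (h / m%:R).
Proof.
move=> m0 [_ _ hm_min] h0 h_hm.
have m0R : 0 < m%:R :> R by rewrite ltr0n.
pose f (x : R) := cos (x / m%:R) + x / (2 * m%:R) * sin (x / m%:R)
                  - cos (pi / m%:R).
have cf : continuous f.
  move=> x; have cm : y / m%:R @[y --> x] --> x / m%:R by exact: mulrr_continuous.
  apply: cvgB; last exact: cvg_cst.
  apply: cvgD; first by apply: continuous_cvg => //; exact: continuous_cos.
  apply: cvgM; first exact: mulrr_continuous.
  by apply: continuous_cvg => //; exact: continuous_sin.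
have f0 : 0 <= f 0 by rewrite /f !mul0r cos0 addr0 subr_ge0 cos_le1.
suff : 0 < f h by rewrite /f; lra.
rewrite ltNge; apply/negP => fh.
have [||c cI fc] := @IVT R f 0 h 0 (ltW h0).
- exact: continuous_subspaceT.
- by rewrite ge_min fh orbT le_max f0.
move: cI; rewrite in_itv /= le_eqVlt => /andP[/predU1P[c0|c0] ch].
  have : 0 < f 0.
    have pm0 : 0 < pi / m%:R :> R by rewrite divr_gt0 ?pi_gt0.
    have pm : pi / m%:R <= pi :> R.
      by rewrite ler_pdivrMr // ler_peMr ?pi_ge0 // ler1n.
    rewrite /f !mul0r cos0 addr0 subr_gt0 -[X in _ < X]cos0.
    by rewrite ltr_cos // in_itv /= ?lexx ?pi_ge0 // pm ltW.
  by rewrite [X in f X]c0 fc ltxx.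
have : hm_equation m c by rewrite /hm_equation; move: fc; rewrite /f; lra.
by move=> /(hm_min c c0); rewrite leNgt (le_lt_trans ch).
Qed.

(** At step length [m pi] the preceding inequality would read [cos (pi / m) + 1 < 0]. *)
Lemma lt_smallest_positive_root_mpi (R : realType) (m : nat) (hm h : R) :
  (0 < m)%N -> smallest_positive_root m hm -> h < hm -> h < m%:R * pi.
Proof.
move=> m0 hmP h_hm; rewrite ltNge; apply/negP => pi_h.
have m0R : 0 < m%:R :> R by rewrite ltr0n.
have := lt_smallest_positive_root m0 hmP _ (le_lt_trans pi_h h_hm).
rewrite mulr_gt0 ?pi_gt0 // => /(_ isT).
rewrite [m%:R * pi / m%:R]mulrAC divff ?gt_eqF // mul1r cospi sinpi mulr0.
by have := cos_geN1 (pi / m%:R : R); lra.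
Qed.

(** * Comparison with RKRm at the extrema of the Chebyshev polynomial *)

Lemma chebyshevT_node (R : realType) (m j : nat) : (0 < m)%N ->
  (chebyshevT R m).[cos (j%:R * pi / m%:R)] = (-1) ^+ j.
Proof.
move=> m0; rewrite chebyshevT_cos mulrC divfK ?pnatr_eq0 -?lt0n //.
elim: j => [|j IH]; first by rewrite mul0r cos0 expr0.
by rewrite -natr1 mulrDl mul1r cosDpi IH exprS mulN1r.
Qed.

Lemma unstable_set_open (R : realType) (M : R -> R -> 'M[R]_2) (h : R)
    (P : {poly R}) : (forall eps, stability_poly M eps h = P.[eps]) ->
  open (unstable_set M h).
Proof.
move=> MP; have -> : unstable_set M h =
    `]-1, +oo[%classic `&` (fun eps => `|P.[eps]|) @^-1` `]1, +oo[%classic.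
  apply/seteqP; split=> eps;
    by rewrite /unstable_set /exp_unstable /= MP !in_itv /= !andbT => -[].
apply: openI; first exact: interval_open.
apply: open_comp => [eps _|]; last exact: interval_open.
by apply: continuous_comp; [exact: continuous_horner|exact: norm_continuous].
Qed.

Lemma stable_splitting_poly_unique (R : realType) (m : nat) (h : R)
    (P Q : {poly R}) :
  (0 < m)%N -> 0 < h -> h < m%:R * pi ->
  cos (pi / m%:R) - cos (h / m%:R) < h / (2 * m%:R) * sin (h / m%:R) ->
  (forall j : nat, (1 <= j < m)%N -> h <> j%:R * pi) ->
  (size P <= m.+1)%N -> (size Q <= m.+1)%N ->
  P`_0 = Q`_0 -> P`_1 = Q`_1 ->
  (forall eps, Q.[eps] = RKRm_poly m eps h) ->
  (forall eps : R, -1 < eps -> eps <= beta m h -> `|P.[eps]| <= 1) ->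
  P = Q.
Proof.
move=> m0 h0 hpi h_small h_neq sP sQ PQ0 PQ1 QE P_le1.
have m0R : 0 < m%:R :> R by rewrite ltr0n.
have m_neq0 : m%:R != 0 :> R by rewrite gt_eqF.
have h_neq0 : h != 0 by rewrite gt_eqF.
pose t := h / m%:R.
have t0 : 0 < t by rewrite divr_gt0.
have t_pi : t < pi by rewrite ltr_pdivrMr // mulrC.
have s0 : 0 < sin t by rewrite sin_gt0_pi // t0.
have s_neq0 : sin t != 0 by rewrite gt_eqF.
(* The shift [j.+1] leaves out the angle 0, where [x = 1], that is, [eps <= -1]. *)
pose node (j : nat) : R := j.+1%:R * pi / m%:R.
have node_itv (j : nat) : (j < m)%N -> node j \in `[0, pi].
  move=> jm; rewrite in_itv /= divr_ge0 ?mulr_ge0 ?pi_ge0 //=.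
  by rewrite ler_pdivrMr // mulrC ler_pM2l ?pi_gt0 // ler_nat.
have t_itv : t \in `[0, pi] by rewrite in_itv /= !ltW.
pose a (j : nat) : R := (cos t - cos (node j)) / (h / (2 * m%:R) * sin t).
have d0 : 0 < h / (2 * m%:R) * sin t by rewrite mulr_gt0 // divr_gt0 // mulr_gt0.
have Qa (j : nat) : Q.[a j] = (-1) ^+ j.+1.
  rewrite QE /RKRm_poly -(@chebyshevT_node R m j.+1 m0) -/t; congr (_.[_]).
  by rewrite /a; field; rewrite m_neq0 s_neq0 h_neq0.
have node_incr (i j : nat) : (i < j)%N -> node i < node j.
  by move=> ij; rewrite ltr_pM2r ?invr_gt0 // ltr_pM2r ?pi_gt0 // ltr_nat.
have a_incr (i j : nat) : (i < j)%N -> (j < m)%N -> a i < a j.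
  move=> ij jm; rewrite ltr_pM2r ?invr_gt0 // ltrD2l ltrN2 ltr_cos ?node_itv //.
  - exact: node_incr.
  - exact: ltn_trans jm.
have a_gtN1 (j : nat) : (j < m)%N -> -1 < a j.
  move=> jm; suff : -1 < a 0%N.
    by case: j jm => // j jm /lt_trans; apply; apply: a_incr.
  rewrite /a /node mul1r ltr_pdivlMr // mulN1r -/t.
  by move: h_small; rewrite -/t; lra.
(* At [a j] the value of [Q] has modulus 1, so the threshold has not been passed. *)
have a_leb (j : nat) : (j < m)%N -> a j <= beta m h.
  move=> jm; rewrite leNgt -RKRm_poly_gt1 ?a_gtN1 // -QE Qa.
  by rewrite normrX normrN1 expr1n ltxx.
(* If [a j = 0] then [h = j.+1 pi]: excluded by [h_neq] when [j.+1 < m], and by [h < m pi] when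
   [j.+1 = m]. *)
have a_neq0 (j : nat) : (j < m)%N -> a j != 0.
  move=> jm; rewrite mulf_neq0 ?invr_eq0 ?(gt_eqF d0) // subr_eq0.
  apply/eqP => /(f_equal (@acos R)); rewrite !cosK ?node_itv // => /eqP.
  rewrite /t /node eqr_div // => /eqP /(mulIf m_neq0) hE.
  have [jm'|jm'] := ltnP j.+1 m; first by case: (h_neq j.+1).
  by move: hpi; rewrite hE (_ : j.+1 = m) ?ltxx //; apply/eqP; rewrite eqn_leq jm.
pose D := P - Q; pose E := drop_poly 2 D.
have DE : D = E * 'X^2.
  rewrite -[LHS](poly_take_drop 2) -[RHS]add0r; congr (_ + _).
  apply/polyP => i; rewrite coef_take_poly coef0 /D coefB.
  by case: i => [|[|i]]; rewrite ?PQ0 ?PQ1 ?subrr.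
suff E0 : E = 0 by apply/eqP; rewrite -subr_eq0 -/D DE E0 mul0r.
apply: (@weakly_alternating_poly_eq0 _ m.-1 a) => [i im||i im].
- by apply: a_incr => //; rewrite -ltn_predRL.
- rewrite size_drop_poly leq_subLR (leq_trans (size_polyD _ _)) // geq_max.
  by rewrite size_polyN add2n prednK // sP.
have {}im : (i < m)%N by rewrite -(prednK m0) ltnS.
have ai0 : 0 < a i ^+ 2 by rewrite exprn_even_gt0 //= a_neq0.
rewrite -(pmulr_lge0 _ ai0) -mulrA.
(* Multiplied by [(-1) ^+ i], the right-hand side becomes [(-1) ^+ i * P.[a i] + 1], nonnegative
   since [|P.[a i]| <= 1]. *)
have -> : E.[a i] * a i ^+ 2 = P.[a i] - (-1) ^+ i.+1.
  by rewrite -Qa -[a i ^+ 2]hornerXn -hornerM -DE hornerD hornerN.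
have := P_le1 (a i) (a_gtN1 i im) (a_leb i im).
rewrite ler_norml exprS => /andP[P1 P2].
by rewrite -signr_odd; case: odd; rewrite ?expr0 ?expr1; lra.
Qed.

Theorem theorem3p1 (R : realType) (m : nat) (m_ge1 : (1 <= m)%N)
    (hm : R) (hmP : smallest_positive_root m hm) :
  (forall h eps : R, 0 < h -> h < m%:R * pi -> -1 < eps ->
     (exp_unstable (@RKRm R m) eps h <-> eps \in `]beta m h, +oo[) /\
     (exp_unstable (@KRKm R m) eps h <-> eps \in `]beta m h, +oo[))
  /\
  (forall h eps : R, 0 < h ->
     stability_poly (@RKRm R m) eps h = RKRm_poly m eps h /\
     stability_poly (@KRKm R m) eps h = RKRm_poly m eps h)
  /\
  (forall (psi : splitting R m) (h : R),
     consistent psi ->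
     0 < h -> h < hm ->
     (forall j : nat, (1 <= j < m)%N -> h <> j%:R * pi) ->
     (fun eps => stability_poly (splitting_mx psi) eps h) <>
       (fun eps => RKRm_poly m eps h) ->
     open (unstable_set (splitting_mx psi) h) /\
     ~ (unstable_set (splitting_mx psi) h `<=` `]beta m h, +oo[)).
Proof.
split=> [h eps h0 hpi eps1|].
  rewrite /exp_unstable stability_poly_RKRm // stability_poly_KRKm //.
  by rewrite RKRm_poly_gt1 // in_itv /= andbT.
split=> [h eps _|psi h psiC h0 h_hm h_neq psi_neq].
  by rewrite stability_poly_RKRm // stability_poly_KRKm.
have [P [sP PE P0 P1]] := tr_splitting_mx_poly h m_ge1 psiC.
have [Q [sQ QE Q0 Q1]] := tr_RKRm_poly h m_ge1.
have spE eps : stability_poly (splitting_mx psi) eps h = (2^-1 *: P).[eps].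
  by rewrite /stability_poly PE hornerZ mulrC.
have sqE eps : (2^-1 *: Q).[eps] = RKRm_poly m eps h.
  by rewrite -stability_poly_RKRm // /stability_poly QE hornerZ mulrC.
split; first exact: unstable_set_open spE.
(* If the unstable set lay inside the interval, [psi] would be stable on []-1, beta m h]], forcing
   the two semitraces to coincide. *)
move=> sub; apply: psi_neq; apply/funext => eps; rewrite spE -sqE; congr (_.[_]).
apply: (@stable_splitting_poly_unique _ m h) => //.
- exact: lt_smallest_positive_root_mpi hmP h_hm.
- exact: lt_smallest_positive_root hmP h0 h_hm.
- exact: leq_trans (size_scale_leq _ _) sP.
- exact: leq_trans (size_scale_leq _ _) sQ.
- by rewrite !coefZ P0 Q0.
- by rewrite !coefZ P1 Q1.
move=> e e1 e_beta; rewrite -spE leNgt; apply/negP => e_unst.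
have /sub : unstable_set (splitting_mx psi) h e by [].
by rewrite /= in_itv /= andbT ltNge e_beta.
Qed.
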